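(* Let $(X,d,A)$ be a metric pair such that $(X/A,d_1,[A])$ is separable and not uniformly discrete, and let $B=\widehat V(X,A)$. Let $(J_1,\Sigma_1)$ and $(J_2,\Sigma_2)$ be admissible covariance data on $B$, and let $Q_i:=Q_{J_i,\Sigma_i}\colon B\to B^\ast$ be the associated covariance operators. Define Hilbertian seminorms $s_i(x):=\langle Q_ix,x\rangle_{B,B^\ast}^{1/2}$ for $x\in B$, $i\in\{1,2\}$. Then $$\ker(Q_1)=\ker(Q_2)\quad\text{and}\quad 0<\inf_{\langle Q_1x,x\rangle>0}\frac{\langle Q_2x,x\rangle}{\langle Q_1x,x\rangle}\le\sup_{\langle Q_1x,x\rangle>0}\frac{\langle Q_2x,x\rangle}{\langle Q_1x,x\rangle}<\infty$$ if and only if $$s_2(x)\le\left(\sup_{\langle Q_1y,y\rangle>0}\frac{\langle Q_2y,y\rangle}{\langle Q_1y,y\rangle}\right)^{1/2}s_1(x)\quad\text{and}\quad s_2(x)\ge\left(\inf_{\langle Q_1y,y\rangle>0}\frac{\langle Q_2y,y\rangle}{\langle Q_1y,y\rangle}\right)^{1/2}s_1(x)\quad\text{for all }x\in B.$$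
   Context: A metric pair $(X,d,A)$ is a metric space $(X,d)$ with a distinguished subset $A\subseteq X$. Put $d(x,A):=\inf_{a\in A}d(x,a)$ and $d_1(x,y):=\min\bigl(d(x,y),\,d(x,A)+d(y,A)\bigr)$. Let $X/A$ be the quotient collapsing $A$ to a point $[A]$; $d_1$ descends to $X/A$ and is assumed to be a genuine metric there, so that $(X/A,d_1,[A])$ is a pointed metric space. A metric space is uniformly discrete if distances between distinct points are bounded below by some $\varepsilon>0$. $V(X,A):=V(X)/V(A)$, where $V(Y)$ is the free real vector space on $Y$; it has basis $(e_u)_{u\in X/A\setminus\{[A]\}}$ and norm $\|\sum_uc_ue_u\|_{W_1}=\sup\{\sum_uc_uf(u): f\colon X/A\to\mathbb R,\ f([A])=0,\ \mathrm{Lip}_{d_1}(f)\le1\}$. $B=\widehat V(X,A)$ is its Banach completion, canonically isometric to the Lipschitz-free space $\mathcal F(X/A,d_1)$. Admissible covariance data $(J,\Sigma)$: choose a sequence $(\ell_n)_{n\ge1}\subset B^\ast$ with $\|\ell_n\|_{B^\ast}\le1$ that is norming ($\|x\|_{W_1}=\sup_n|\ell_n(x)|$ for all $x\in B$) and a strictly positive weight sequence $(w_n)_{n\ge1}\in\ell^2$; set $J\colon B\to\ell^2$, $Jx:=(w_n\ell_n(x))_{n\ge1}$. $\Sigma$ is a bounded, self-adjoint, positive, trace-class operator on $\ell^2$ that is diagonal in the standard orthonormal basis $(e_n)_{n\ge1}$: $\Sigma e_n=\sigma_ne_n$ with $\sigma_n\ge0$ and $\sum_n\sigma_n<\infty$.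 The covariance operator $Q_{J,\Sigma}\colon B\to B^\ast$ is given by $\langle Q_{J,\Sigma}x,y\rangle_{B,B^\ast}=\langle\Sigma Jx,Jy\rangle_{\ell^2}$ for $x,y\in B$. The infima and suprema are taken over elements of $B$, and $\langle\cdot,\cdot\rangle$ without subscript means $\langle\cdot,\cdot\rangle_{B,B^\ast}$.
   Formalization: The right-hand side additionally requires that the infimum and supremum of the ratios be positive and finite; without this the ''if'' direction fails, e.g. for Σ₂ = 0 and Q₁ ≠ 0, where both inequalities read 0 ≤ 0 but 0 < inf is false. *)

(* Defs.v *)
From HB Require Import structures.
From mathcomp Require Import all_boot all_order all_algebra generic_quotient.
From mathcomp Require Import freeg.
From mathcomp Require Import all_classical all_reals all_analysis.
From mathcomp Require Import ring lra.

Set Implicit Arguments.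
Unset Strict Implicit.
Unset Printing Implicit Defensive.

Import Order.TTheory GRing.Theory Num.Theory.
Import numFieldNormedType.Exports.

Local Open Scope classical_set_scope.
Local Open Scope ring_scope.
Local Open Scope quotient_scope.

Section distance_functions.
Context {R : realType} {T : Type}.
Implicit Type d : T -> T -> R.

Definition is_metric d :=
  [/\ forall x y, d x y = 0 <-> x = y,
      forall x y, d x y = d y x
    & forall x y z, d x z <= d x y + d y z].

Definition separable_metric d :=
  exists2 D : set T, countable D &
    forall x e, 0 < e -> exists2 y, D y & d x y < e.

Definition uniformly_discrete d :=
  exists2 e : R, 0 < e & forall x y, x <> y -> e <= d x y.

(* Lip_d(f) <= 1 and f(p) = 0. *)
Definition pointed_lip1 d (p : T) : set (T -> R) :=
  [set f | f p = 0 /\ forall x y, `|f x - f y| <= d x y].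

End distance_functions.

Section collapse.
Context {R : realType} {X : metricType R} (A : set X).

Definition collapse_rel : rel X := fun x y => `[< x = y \/ (A x /\ A y) >].

Lemma collapse_rel_is_equiv : equiv_class_of collapse_rel.
Proof.
split=> [x|x y|y x z].
- by apply/asboolP; left.
- by apply/asboolP/asboolP => -[->|[? ?]]; by [left|right].
- move=> /asboolP[->//|[Ax Ay]] /asboolP[<-|[_ Az]];
    by apply/asboolP; right.
Qed.

Canonical collapse_equiv := EquivRelPack collapse_rel_is_equiv.
Canonical collapse_encModRel := defaultEncModRel collapse_rel.

Definition collapse := {eq_quot collapse_rel}.

HB.instance Definition _ := Choice.on collapse.
HB.instance Definition _ : EqQuotient X collapse_rel collapse :=
  EqQuotient.on collapse.

Definition collapse_proj : X -> collapse := \pi_collapse.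

(* The point [A] of X/A; by collapse_pointE it does not depend on the choice
   made here. *)
Definition collapse_point (A0 : A !=set0) : collapse :=
  collapse_proj (projT1 (cid A0)).

Lemma collapse_pointE (A0 : A !=set0) a :
  A a -> collapse_proj a = collapse_point A0.
Proof.
move=> Aa; apply/eqP; rewrite /collapse_point eqmodE; apply/asboolP; right.
by split=> //; exact: projT2.
Qed.

Lemma collapse_projP x y :
  collapse_proj x = collapse_proj y <-> x = y \/ (A x /\ A y).
Proof.
split=> [/eqP|xy]; first by rewrite eqmodE => /asboolP.
by apply/eqP; rewrite eqmodE; apply/asboolP.
Qed.

Definition dist_set (x : X) : R := inf [set mdist x a | a in A].

Definition d1 (x y : X) : R := Num.min (mdist x y) (dist_set x + dist_set y).

(* d1 read on representatives; see collapse_distE. *)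
Definition collapse_dist (u v : collapse) : R := d1 (repr u) (repr v).

Lemma dist_set_lb x : lbound [set mdist x a | a in A] 0.
Proof. by move=> _ [a _ <-]; exact: mdist_ge0. Qed.

Lemma dist_set_le x a : A a -> dist_set x <= mdist x a.
Proof.
by move=> Aa; apply: ge_inf; [exists 0; exact: dist_set_lb|exists a].
Qed.

Lemma dist_set_ge0 x : A !=set0 -> 0 <= dist_set x.
Proof.
by move=> [a Aa]; apply: lb_le_inf; [exists (mdist x a); exists a|
  exact: dist_set_lb].
Qed.

Lemma dist_set0 a : A a -> dist_set a = 0.
Proof.
move=> Aa; apply/eqP; rewrite eq_le dist_set_ge0 ?andbT; last by exists a.
by rewrite (le_trans (dist_set_le _ Aa))// mdistxx.
Qed.

Lemma d1C x y : d1 x y = d1 y x.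
Proof. by rewrite /d1 metric_sym addrC. Qed.

Lemma d1A a y : A a -> d1 a y = dist_set y.
Proof.
move=> Aa; rewrite /d1 dist_set0// add0r; apply/min_idPr.
by rewrite metric_sym dist_set_le.
Qed.

Lemma collapse_distE x y : collapse_dist (collapse_proj x) (collapse_proj y) =
  d1 x y.
Proof.
have rE z : collapse_proj (repr (collapse_proj z)) = collapse_proj z.
  exact: reprK.
have d1l z t : d1 (repr (collapse_proj z)) t = d1 z t.
  by have /collapse_projP[->//|[Ar Az]] := rE z; rewrite !d1A.
by rewrite /collapse_dist d1l d1C d1l d1C.
Qed.

End collapse.

HB.instance Definition _ (R : nzRingType) (K : choiceType) (M : lmodType R)
    (f : K -> M) := GRing.isZmodMorphism.Build {freeg K / R} M (fglift f)
  (lift_is_additive f).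

(* V(X,A) = V(X) / V(A). *)
Section virtual_space.
Context {R : realType} {X : metricType R} (A : set X).
Local Notation VX := {freeg X / R}.

(* V(A), the vectors of V(X) all of whose support lies in A. *)
Definition supported_in : {pred VX} :=
  fun c => `[< forall x, coeff x c != 0 -> A x >].

Lemma supported_in_zmod_closed : zmod_closed supported_in.
Proof.
split; first by apply/asboolP => x; rewrite coeff0 eqxx.
move=> c c' /asboolP cA /asboolP c'A; apply/asboolP => x.
rewrite coeffB; have [->|/cA//] := eqVneq (coeff x c) 0.
by rewrite sub0r oppr_eq0 => /c'A.
Qed.

HB.instance Definition _ :=
  GRing.isZmodClosed.Build VX supported_in supported_in_zmod_closed.

Definition virtual := Quotient.quot supported_in.

HB.instance Definition _ := GRing.Zmodule.on virtual.
HB.instance Definition _ := EqQuotient.on virtual.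

Definition virtual_proj : VX -> virtual := \pi_virtual.

Lemma virtual_projP c c' :
  virtual_proj c = virtual_proj c' <-> c - c' \in supported_in.
Proof. by rewrite Quotient.idealrBE; split=> /eqP. Qed.

Lemma virtual_projD c c' :
  virtual_proj (c + c') = virtual_proj c + virtual_proj c'.
Proof. exact: (@pi_addr _ _ _ _ _ (Quotient.quot supported_in)). Qed.

Definition virtual_scale (r : R) (v : virtual) : virtual :=
  virtual_proj (r *: repr v).

Lemma virtual_scaleE r c :
  virtual_scale r (virtual_proj c) = virtual_proj (r *: c).
Proof.
apply/virtual_projP; rewrite -scalerBr.
have /virtual_projP /asboolP h :
  virtual_proj (repr (virtual_proj c)) = virtual_proj c by exact: reprK.
apply/asboolP => x; rewrite coeffZ mulf_eq0 negb_or => /andP[_]; exact: h.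
Qed.

Lemma virtual_reprK v : virtual_proj (repr v) = v.
Proof. exact: reprK. Qed.

Lemma virtual_scaleA r s v :
  virtual_scale r (virtual_scale s v) = virtual_scale (r * s) v.
Proof. by rewrite -[v]virtual_reprK !virtual_scaleE scalerA. Qed.

Lemma virtual_scale1 : left_id 1 virtual_scale.
Proof. by move=> v; rewrite -[v]virtual_reprK virtual_scaleE scale1r. Qed.

Lemma virtual_scaleDr : right_distributive virtual_scale +%R.
Proof.
move=> r v w; rewrite -[v]virtual_reprK -[w]virtual_reprK.
by rewrite -virtual_projD !virtual_scaleE scalerDr virtual_projD.
Qed.

Lemma virtual_scaleDl v :
  {morph virtual_scale^~ v : r s / r + s >-> r + s}.
Proof.
move=> r s; rewrite -[v]virtual_reprK !virtual_scaleE.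
by rewrite scalerDl virtual_projD.
Qed.

HB.instance Definition _ := GRing.Zmodule_isLmodule.Build R virtual
  virtual_scaleA virtual_scale1 virtual_scaleDr virtual_scaleDl.

(* For v the class of \sum_x c_x x, the sum \sum_x c_x f([x]), that is
   \sum_u c_u f(u) in the basis (e_u) when f([A]) = 0; see virtual_pairE. *)
Definition virtual_pair (f : collapse A -> R) (v : virtual) : R :=
  \sum_(x <- dom (repr v)) coeff x (repr v) * f (collapse_proj A x).

Lemma fglift_sum (f : X -> R) (c : VX) :
  fglift (f : X -> R^o) c = \sum_(x <- dom c) coeff x c * f x.
Proof.
rewrite -{1}[c]freeg_sumE raddf_sum /=.
by apply: eq_bigr => x _; rewrite liftU.
Qed.

Lemma virtual_pairE (A0 : A !=set0) (f : collapse A -> R) (c : VX) :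
  f (collapse_point A0) = 0 ->
  virtual_pair f (virtual_proj c) =
  \sum_(x <- dom c) coeff x c * f (collapse_proj A x).
Proof.
move=> f0; rewrite /virtual_pair -!fglift_sum; apply/eqP.
rewrite -subr_eq0 -(lift_is_additive (_ : X -> R^o)) fglift_sum big1_seq//= => x.
have /virtual_projP /asboolP h := virtual_reprK (virtual_proj c).
have [->|/h Ax _] := eqVneq (coeff x (repr (virtual_proj c) - c)) 0.
  by rewrite mul0r.
by rewrite (collapse_pointE A0 Ax) f0 mulr0.
Qed.

Definition W1norm (A0 : A !=set0) (v : virtual) : \bar R :=
  ereal_sup [set (virtual_pair f v)%:E |
    f in pointed_lip1 (@collapse_dist R X A) (collapse_point A0)].

End virtual_space.

(* B, with i : V -> B, is the Banach completion of the space V normed by N. *)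
Definition is_banach_completion (R : realType) (V : lmodType R)
    (N : V -> \bar R) (B : completeNormedModType R) (i : {linear V -> B}) :=
  (forall v, `|i v|%:E = N v) /\ dense (range i).

(* The topological dual B^*. *)
Section dual.
Context {R : realType} (B : normedModType R).

Structure dual := Dual {
  dual_fun :> {linear B -> R^o};
  dual_continuous : continuous dual_fun }.

Definition dual_norm (l : dual) : \bar R :=
  ereal_sup [set `|l x|%:E | x in [set x : B | `|x| <= 1]].

Definition dual_ker (Q : B -> dual) : set B :=
  [set x | forall y, Q x y = 0].

Lemma dual_norm_le1 (l : dual) x : (dual_norm l <= 1)%E -> `|l x| <= `|x|.
Proof.
move=> l1; have [->|x0] := eqVneq x 0; first by rewrite linear0 !normr0.
have nx0 : 0 < `|x| by rewrite normr_gt0.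
have : (`|l (`|x|^-1 *: x)|%:E <= 1)%E.
  apply: le_trans l1; apply: ereal_sup_ubound; exists (`|x|^-1 *: x) => //=.
  by rewrite normrZ ger0_norm ?invr_ge0// mulVf// gt_eqF.
rewrite lee_fin linearZ /= normrZ ger0_norm ?invr_ge0//.
by rewrite ler_pdivrMl// mulr1.
Qed.

End dual.

(* The Hilbert space l^2, indexed from 0. *)
Section l2.
Context {R : realType}.

Definition square_summable : {pred nat -> R^o} :=
  fun a => `[< cvgn (series (fun n => a n ^+ 2 : R)) >].

Lemma summable_mul (a b : nat -> R^o) :
  a \in square_summable -> b \in square_summable ->
  cvgn (series (fun n => `|a n * b n| : R)).
Proof.
move=> /asboolP a2 /asboolP b2.
apply: (series_le_cvg (v_ := (fun n => a n ^+ 2 : R) + (fun n => b n ^+ 2 : R))).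
- by move=> n; exact: normr_ge0.
- by move=> n; rewrite addr_ge0// sqr_ge0.
- move=> n; rewrite normrM -[leRHS]/(a n ^+ 2 + b n ^+ 2).
  rewrite -(real_normK (num_real (a n))) -(real_normK (num_real (b n))).
  have := sqr_ge0 (`|a n| - `|b n|); have := normr_ge0 (a n).
  have := normr_ge0 (b n); nra.
- by rewrite seriesD; exact: is_cvgD.
Qed.

Lemma square_summable_submod_closed : submod_closed square_summable.
Proof.
split.
  apply/asboolP; rewrite (_ : (fun n => _) = fun=> 0).
    apply/cvg_ex; exists 0; rewrite /series /=.
    by under eq_fun do rewrite big1//; exact: cvg_cst.
  by apply/funext => n; rewrite expr0n.
move=> r a b aS bS; have := summable_mul aS bS => /normed_cvg ab.
move: aS bS => /asboolP a2 /asboolP b2; apply/asboolP.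
pose a2f : nat -> R^o := fun n => a n ^+ 2.
pose abf : nat -> R^o := fun n => a n * b n.
pose b2f : nat -> R^o := fun n => b n ^+ 2.
rewrite (_ : (fun n => _) = r ^+ 2 *: a2f + ((r *+ 2) *: abf + b2f)).
  apply: is_cvg_seriesD; first exact: is_cvg_seriesZ.
  by apply: is_cvg_seriesD => //; exact: is_cvg_seriesZ.
apply/funext => n; rewrite /= -[LHS]/((r * a n + b n) ^+ 2).
rewrite -[RHS]/(r ^+ 2 * a n ^+ 2 + (r *+ 2 * (a n * b n) + b n ^+ 2)).
by ring.
Qed.

HB.instance Definition _ := GRing.isSubmodClosed.Build R (nat -> R^o)
  square_summable square_summable_submod_closed.

Record l2 := L2 {
  l2_seq :> nat -> R^o;
  l2_subproof : l2_seq \in square_summable }.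

HB.instance Definition _ := [isSub for l2_seq].
HB.instance Definition _ := [Choice of l2 by <:].
HB.instance Definition _ := [SubChoice_isSubLmodule of l2 by <:].

Definition l2_dot (a b : l2) : R := limn (series (fun n => a n * b n : R)).

Definition l2_norm (a : l2) : R := Num.sqrt (l2_dot a a).

Lemma delta_square_summable k : (fun n => (n == k)%:R) \in square_summable.
Proof.
apply/asboolP/cvg_ex; exists 1; apply: cvg_near_cst; exists k.+1 => //= n kn.
rewrite /series /= big_mkord (bigD1 (Ordinal kn))//= eqxx expr1n.
rewrite big1 ?addr0// => i; rewrite -val_eqE/= => /negbTE ->.
by rewrite expr0n.
Qed.

(* The standard orthonormal basis. *)
Definition l2_basis (k : nat) : l2 := L2 (delta_square_summable k).

Definition l2_bounded (S : l2 -> l2) :=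
  exists M : R, forall a, l2_norm (S a) <= M * l2_norm a.

Definition l2_self_adjoint (S : l2 -> l2) :=
  forall a b, l2_dot (S a) b = l2_dot a (S b).

Definition l2_positive (S : l2 -> l2) := forall a, 0 <= l2_dot (S a) a.

(* For a positive operator, being trace-class is the finiteness of
   \sum_n <S e_n, e_n> in an orthonormal basis. *)
Definition l2_positive_trace_class (S : l2 -> l2) :=
  cvgn (series (fun n => l2_dot (S (l2_basis n)) (l2_basis n))).

End l2.
Arguments l2 : clear implicits.

Section covariance.
Context {R : realType} (B : normedModType R).

(* Admissible covariance data (J, Sigma) on B. *)
Structure covariance_data := CovarianceData {
  cov_ell : nat -> dual B;
  cov_ell_le1 : forall n, (dual_norm (cov_ell n) <= 1)%E;
  cov_ell_norming : forall x : B,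
    `|x|%:E = ereal_sup [set `|cov_ell n x|%:E | n in [set: nat]];
  cov_weight : l2 R;
  cov_weight_gt0 : forall n, 0 < cov_weight n;
  cov_op : {linear l2 R -> l2 R};
  cov_op_bounded : l2_bounded cov_op;
  cov_op_self_adjoint : l2_self_adjoint cov_op;
  cov_op_positive : l2_positive cov_op;
  cov_op_trace_class : l2_positive_trace_class cov_op;
  cov_sigma : nat -> R;
  cov_sigma_ge0 : forall n, 0 <= cov_sigma n;
  cov_sigma_summable : cvgn (series cov_sigma);
  cov_op_diagonal : forall n,
    cov_op (l2_basis n) = cov_sigma n *: l2_basis n }.

Variable D : covariance_data.

Lemma cov_J_subproof (x : B) :
  (fun n => cov_weight D n * cov_ell D n x) \in square_summable.
Proof.
have /asboolP w2 := l2_subproof (cov_weight D); apply/asboolP.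
pose w2f : nat -> R^o := fun n => cov_weight D n ^+ 2.
apply: (@series_le_cvg _ _ (`|x| ^+ 2 *: w2f)).
- by move=> n; rewrite sqr_ge0.
- by move=> n; rewrite /GRing.scale/= mulr_ge0// sqr_ge0.
- move=> n; rewrite exprMn mulrC ler_wpM2r ?sqr_ge0//.
  rewrite -(real_normK (num_real (cov_ell D n x))) lerXn2r ?nnegrE//.
  exact/dual_norm_le1/cov_ell_le1.
- exact: is_cvg_seriesZ.
Qed.

Definition cov_J (x : B) : l2 R := L2 (cov_J_subproof x).

Definition cov_form (x y : B) : R := l2_dot (cov_op D (cov_J x)) (cov_J y).

Let form_cvg x y : cvgn (series
  (fun n => (cov_op D (cov_J x)) n * cov_J y n : R)).
Proof. by apply/normed_cvg/summable_mul; exact: l2_subproof. Qed.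

Lemma cov_form_linear x : linear (cov_form x : B -> R^o).
Proof.
move=> r y z; rewrite /cov_form /l2_dot.
set s := cov_op D (cov_J x).
pose sy : nat -> R^o := fun n => s n * cov_J y n.
pose sz : nat -> R^o := fun n => s n * cov_J z n.
rewrite (_ : (fun n => _) = r *: sy + sz); last first.
  apply/funext => n; rewrite -[RHS]/(r * (s n * cov_J y n) + s n * cov_J z n).
  by rewrite /= linearP /= /GRing.scale /=; ring.
rewrite lim_seriesD; [|apply: is_cvg_seriesZ|]; try exact: form_cvg.
by rewrite lim_seriesZ//; exact: form_cvg.
Qed.

HB.instance Definition _ x := GRing.isLinear.Build R B R^o _ (cov_form x)
  (cov_form_linear x).

Lemma cov_form_continuous x : continuous (cov_form x : B -> R^o).
Proof.
set s := cov_op D (cov_J x).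
have sw : cvgn (series (fun n => `|s n * cov_weight D n| : R)).
  by apply: summable_mul; exact: l2_subproof.
apply: bounded_linear_continuous; apply/ex_bound.
exists (limn (series (fun n => `|s n * cov_weight D n| : R))).
apply/nbhs_norm0P; exists 1 => //= y /ltW y1.
have le n : `|s n * cov_J y n| <= `|s n * cov_weight D n|.
  rewrite /= mulrA normrM ler_piMr//.
  exact: le_trans (dual_norm_le1 y (cov_ell_le1 D n)) y1.
have yw : cvgn (series (fun n => `|s n * cov_J y n| : R)).
  exact: (series_le_cvg _ _ le).
apply: le_trans (lim_series_norm yw) _.
exact: lim_series_le.
Qed.

(* Q : B -> B^*, with <Qx, y> = <Sigma Jx, Jy>. *)
Definition cov_Q (x : B) : dual B := Dual (@cov_form_continuous x).

Definition cov_seminorm (x : B) : R := Num.sqrt (cov_Q x x).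

End covariance.

Section ratio.
Context {R : realType} (B : normedModType R) (D1 D2 : covariance_data B).

(* The extrema below are in \bar R: for Q_1 = 0 they are +oo (inf) and
   -oo (sup). *)
Definition cov_ratios : set (\bar R) :=
  [set (cov_Q D2 x x / cov_Q D1 x x)%:E | x in [set x : B | 0 < cov_Q D1 x x]].

Definition cov_ratio_inf : \bar R := ereal_inf cov_ratios.

Definition cov_ratio_sup : \bar R := ereal_sup cov_ratios.

End ratio.

(* Main.v *)
Require Import Defs.
From mathcomp Require Import all_boot all_order all_algebra.
From mathcomp Require Import all_classical all_reals all_analysis.
From mathcomp Require Import ring.

(** Both sides of the equivalence say that the quadratic forms
[q_i x = <Q_i x, x>] satisfy [m * q_1 <= q_2 <= M * q_1], where [m] and [M] are
the extrema of the ratio [q_2 / q_1] over the vectors with [q_1 > 0].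

On those vectors the two bounds hold by the definition of the extrema. On the
vectors with [q_1 x = 0] the ratio says nothing, and the bounds amount to
[q_2 x = 0]. This is where the kernels come in: [Q_i] is symmetric and
positive, so the degenerate case of the Cauchy-Schwarz inequality identifies
[ker Q_i] with the null vectors of [q_i] ([dual_ker_cov_Q]), hence with those of
the seminorm [s_i]. Thus equality of the kernels gives the bounds on null
vectors; conversely, two-sided bounds with positive finite constants force [s_1]
and [s_2] to vanish together, hence the kernels to agree.

The extrema are taken in the extended reals, so their finiteness has to be
accounted for. Over an empty set of ratios the infimum is [+oo] and the supremum
[-oo]; each side excludes this, by [inf <= sup] on the left and by [inf < +oo] on
the right. Once some ratio exists, it lies between the two extrema
([cov_ratio_inf_le_sup]), so that [0 < inf] and [sup < +oo] make both of them
positive reals. *)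

Set Implicit Arguments.
Unset Strict Implicit.
Unset Printing Implicit Defensive.

Import Order.TTheory GRing.Theory Num.Theory.
Import numFieldNormedType.Exports.

Local Open Scope classical_set_scope.
Local Open Scope ring_scope.

(** Degenerate Cauchy-Schwarz: along the line [y + t x] the quadratic form is
affine in [t] with slope [2 q(x, y)], and a nonnegative affine function is
constant. *)
Lemma psd_form_null (R : realFieldType) (V : lmodType R)
    (q : V -> {linear V -> R^o}) :
  (forall x y, q x y = q y x) -> (forall x, 0 <= q x x) ->
  forall x, q x x = 0 -> forall y, q x y = 0.
Proof.
move=> qC q_ge0 x qxx y; apply/eqP; apply: contraT => qxy_neq0.
(* the value of [t] at which the affine function equals [-1] *)
pose t : R := - (q y y + 1) / (2 * q x y).
have q_line : q (t *: x + y) (t *: x + y) = t * q x y *+ 2 + q y y.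
  have expand z : q z (t *: x + y) = t * q x z + q y z.
    by rewrite linearP /= (qC z x) (qC z y).
  by rewrite !expand qxx (qC y x); ring.
have := q_ge0 (t *: x + y); rewrite q_line.
have -> : t * q x y *+ 2 + q y y = -1 by rewrite /t; field.
by rewrite lerNr oppr0 ler10.
Qed.

Section covariance_form.
Context {R : realType} (B : normedModType R) (D : covariance_data B).

Lemma cov_QC x y : cov_Q D x y = cov_Q D y x.
Proof.
rewrite /= /cov_form (@cov_op_self_adjoint _ _ D) /l2_dot.
by congr (limn (series _)); apply/funext => n; rewrite mulrC.
Qed.

Lemma cov_Q_ge0 x : 0 <= cov_Q D x x.
Proof. exact: cov_op_positive. Qed.

Lemma dual_ker_cov_Q x : dual_ker (cov_Q D) x <-> cov_Q D x x = 0.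
Proof.
split=> [|Qxx]; first exact.
by apply: (psd_form_null (q := fun x => cov_Q D x)) => //;
  [exact: cov_QC|exact: cov_Q_ge0].
Qed.

Lemma cov_seminorm_ge0 x : 0 <= cov_seminorm D x.
Proof. exact: sqrtr_ge0. Qed.

Lemma cov_seminorm_eq0 x : cov_seminorm D x = 0 <-> cov_Q D x x = 0.
Proof.
split=> [/eqP|Qxx]; last by rewrite /cov_seminorm Qxx sqrtr0.
by rewrite sqrtr_eq0 => Qxx; apply/eqP; rewrite eq_le Qxx cov_Q_ge0.
Qed.

End covariance_form.

Section comparison.
Context {R : realType} (B : normedModType R) (D1 D2 : covariance_data B).

Lemma cov_ratio_bounds x : 0 < cov_Q D1 x x ->
  (cov_ratio_inf D1 D2 <= (cov_Q D2 x x / cov_Q D1 x x)%:E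
     <= cov_ratio_sup D1 D2)%E.
Proof.
move=> Qx; apply/andP.
by split; [apply: ereal_inf_lbound|apply: ereal_sup_ubound]; exists x.
Qed.

Lemma cov_ratio_inf_le_sup :
  (cov_ratio_inf D1 D2 <= cov_ratio_sup D1 D2)%E <->
  exists x, 0 < cov_Q D1 x x.
Proof.
split=> [|[x /cov_ratio_bounds /andP[inf_le]]]; last exact: le_trans.
apply: contraPP => /forallNP noQ.
have -> : cov_ratio_inf D1 D2 = +oo%E.
  by rewrite /cov_ratio_inf /cov_ratios (_ : [set x | _] = set0)
    ?image_set0 ?ereal_inf0// -subset0 => x /noQ.
have -> : cov_ratio_sup D1 D2 = -oo%E.
  by rewrite /cov_ratio_sup /cov_ratios (_ : [set x | _] = set0)
    ?image_set0 ?ereal_sup0// -subset0 => x /noQ.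
by [].
Qed.

Lemma cov_ratio_inf_lty :
  (cov_ratio_inf D1 D2 < +oo)%E -> exists x, 0 < cov_Q D1 x x.
Proof. by move=> /ereal_inf_lt[_ [x Qx _] _]; exists x. Qed.

(** For positive real extrema, equality of the kernels is what extends the bounds
from the vectors with positive [Q_1] to all of [B]. *)
Lemma cov_seminorm_bounds (m M : R) :
  cov_ratio_inf D1 D2 = m%:E -> cov_ratio_sup D1 D2 = M%:E -> 0 < m -> 0 < M ->
  dual_ker (cov_Q D1) = dual_ker (cov_Q D2) <->
  forall x, cov_seminorm D2 x <= Num.sqrt M * cov_seminorm D1 x /\
            Num.sqrt m * cov_seminorm D1 x <= cov_seminorm D2 x.
Proof.
move=> infE supE m0 M0; split=> [kerE x|bounds].
  have [Q1x|Q1x] := ltP 0 (cov_Q D1 x x).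
    have /andP[] := cov_ratio_bounds Q1x; rewrite infE supE !lee_fin.
    rewrite ler_pdivlMr// ler_pdivrMr// => mQ QM.
    by rewrite /cov_seminorm -!sqrtrM ?(ltW m0) ?(ltW M0)//; split; apply: ler_wsqrtr.
  have {}Q1x : cov_Q D1 x x = 0 by apply/eqP; rewrite eq_le Q1x cov_Q_ge0.
  have Q2x : cov_Q D2 x x = 0.
    by apply/dual_ker_cov_Q; rewrite -kerE dual_ker_cov_Q.
  by rewrite !(iffRL (cov_seminorm_eq0 _ _))// !mulr0.
apply/seteqP; split=> x; rewrite !dual_ker_cov_Q -!cov_seminorm_eq0 => sx;
  have [le2 le1] := bounds x; apply/eqP; rewrite eq_le cov_seminorm_ge0 andbT.
  by rewrite (le_trans le2)// sx mulr0.
by rewrite -(pmulr_rle0 _ (_ : 0 < Num.sqrt m)) ?sqrtr_gt0// -sx.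
Qed.

End comparison.

Theorem theorem4p7 (R : realType) (X : metricType R) (A : set X)
  (A0 : A !=set0)
  (d1_metric : is_metric (@collapse_dist R X A))
  (d1_separable : separable_metric (@collapse_dist R X A))
  (d1_not_discrete : ~ uniformly_discrete (@collapse_dist R X A))
  (B : completeNormedModType R) (i : {linear virtual A -> B})
  (B_completion : is_banach_completion (W1norm A0) i)
  (D1 D2 : covariance_data B) :
  (dual_ker (cov_Q D1) = dual_ker (cov_Q D2) /\
   [/\ (0 < cov_ratio_inf D1 D2)%E,
       (cov_ratio_inf D1 D2 <= cov_ratio_sup D1 D2)%E
     & (cov_ratio_sup D1 D2 < +oo)%E])
  <->
  [/\ (0 < cov_ratio_inf D1 D2 < +oo)%E,
      (0 < cov_ratio_sup D1 D2 < +oo)%E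
    & forall x : B,
        cov_seminorm D2 x
          <= Num.sqrt (fine (cov_ratio_sup D1 D2)) * cov_seminorm D1 x /\
        cov_seminorm D2 x
          >= Num.sqrt (fine (cov_ratio_inf D1 D2)) * cov_seminorm D1 x].
Proof.
have bounds := @cov_seminorm_bounds _ _ D1 D2.
have inf_le := @cov_ratio_inf_le_sup _ _ D1 D2.
have inf_lty := @cov_ratio_inf_lty _ _ D1 D2.
split.
  move=> [kerE [inf0 le_inf_sup supy]].
  have infy := le_lt_trans le_inf_sup supy.
  have sup0 := lt_le_trans inf0 le_inf_sup.
  split; [exact/andP|exact/andP|].
  case: (cov_ratio_inf D1 D2) (cov_ratio_sup D1 D2) bounds inf0 infy sup0 supy
    => [m||] [M||]//= bounds m0 _ M0 _.
  by apply/bounds; rewrite // -lte_fin.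
move=> [/andP[inf0 infy] /andP[sup0 supy] le_s].
split; last by split=> //; exact/inf_le/inf_lty.
case: (cov_ratio_inf D1 D2) (cov_ratio_sup D1 D2)
  bounds inf0 infy sup0 supy le_s => [m||] [M||]//= bounds m0 _ M0 _ le_s.
by apply/(bounds m M); rewrite // -lte_fin.
Qed.
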